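(* Let $K$ be an algebraic number field with ring of integers $O_K$, and let $n\geq 1$. Then the group $T_n(O_K)$ satisfies a positive generalized identity if and only if $K=\mathbb{Q}$ or $K$ is an imaginary quadratic field.
   Context: For a commutative ring $R$, $T_n(R)$ is the group of upper triangular $n\times n$ matrices over $R$ with diagonal entries in the unit group $R^\times$. For a group $G$ write $g^x=x^{-1}gx$. A group $G$ satisfies a positive generalized identity if there exist $k\geq 1$ and fixed elements $g_1,\dots,g_k\in G$ such that $x^{g_1}x^{g_2}\cdots x^{g_k}=1$ for all $x\in G$. *)

(* Defs.v *)
From HB Require Import structures.
From Stdlib Require Import Rdefinitions.
From mathcomp Require Import all_boot all_order all_fingroup all_algebra.
From mathcomp Require Import all_field.
From mathcomp Require Import boolp.
From mathcomp Require Import Rstruct.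

Set Implicit Arguments.
Unset Strict Implicit.
Unset Printing Implicit Defensive.

Import GRing.Theory.
Local Open Scope ring_scope.

(* [x ^ g] is conjugation, [g^-1 * (x * g)]. *)
Definition positive_generalized_identity (G : groupType) : Prop :=
  exists (k : nat) (g : 'I_k -> G),
    (0 < k)%N /\ forall x : G, (\prod_(i < k) x ^ g i = 1)%g.

(* [is_trig_mx] means lower triangular, hence the transpose. *)
Definition is_upper_unit_mx (n : nat) (R : comUnitRingType) (A : 'M[R]_n) :=
  is_trig_mx A^T && [forall i, A i i \is a GRing.unit].

Record upper_group (n : nat) (R : comUnitRingType) := UpperGroup {
  upper_mx :> 'M[R]_n;
  _ : is_upper_unit_mx upper_mx
}.

Section UpperGroup.
Variables (n : nat) (R : comUnitRingType).
Local Notation T := (upper_group n R).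
Implicit Types A B : 'M[R]_n.

HB.instance Definition _ := [isSub for @upper_mx n R].
HB.instance Definition _ := [Choice of T by <:].

Lemma is_upper_unit_mxP A :
  reflect ((forall i j : 'I_n, (j < i)%N -> A i j = 0)
           /\ (forall i, A i i \is a GRing.unit))
          (is_upper_unit_mx A).
Proof.
apply: (iffP andP) => [[/is_trig_mxP AT /forallP AU]|[AT AU]].
  by split=> // i j /AT; rewrite mxE.
by split; [apply/is_trig_mxP => i j /AT; rewrite mxE | apply/forallP].
Qed.

Lemma is_upper_unit_mx1 : is_upper_unit_mx (1%:M : 'M[R]_n).
Proof.
apply/is_upper_unit_mxP; split=> [i j ji|i]; rewrite mxE ?eqxx ?unitr1 //.
by case: eqP ji => // ->; rewrite ltnn.
Qed.

Lemma is_upper_unit_mxM A B :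
  is_upper_unit_mx A -> is_upper_unit_mx B -> is_upper_unit_mx (A *m B).
Proof.
move=> /is_upper_unit_mxP[A0 AU] /is_upper_unit_mxP[B0 BU].
apply/is_upper_unit_mxP; split=> [i j ji|i]; rewrite mxE.
  apply: big1 => l _; case: (ltnP l i) => [/A0->|il]; first by rewrite mul0r.
  by rewrite B0 ?mulr0 // (leq_trans ji).
rewrite (bigD1 i) //= big1 ?addr0 ?unitrM ?AU ?BU // => l li.
case: (ltngtP l i) => [/A0->|/B0->|/val_inj E]; rewrite ?mul0r ?mulr0 //.
by rewrite E eqxx in li.
Qed.

Lemma is_upper_unit_mx_unit A : is_upper_unit_mx A -> A \in unitmx.
Proof.
case/andP=> AT /forallP AU; rewrite unitmxE -det_tr det_trig //.
by apply: rpred_prod => i _; rewrite mxE.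
Qed.

Lemma is_upper_unit_mxV A : is_upper_unit_mx A -> is_upper_unit_mx (invmx A).
Proof.
move=> uA; have /matrixP := mulVmx (is_upper_unit_mx_unit uA).
move/is_upper_unit_mxP: uA => [A0 AU]; set B := invmx A => BA.
have B0 m (i j : 'I_n) : j = m :> nat -> (j < i)%N -> B i j = 0.
  elim/ltn_ind: m i j => m IH i j jm ji; apply: (mulIr (AU j)); rewrite mul0r.
  have := BA i j; rewrite !mxE (bigD1 j) //= big1 ?addr0 => [->|l lj].
    by case: eqP ji => // ->; rewrite ltnn.
  case: (ltngtP l j) => [l_lt_j|/A0->|/val_inj E]; rewrite ?mulr0 //.
    by rewrite (IH l) ?mul0r -?jm // (ltn_trans l_lt_j).
  by rewrite E eqxx in lj.
apply/is_upper_unit_mxP; split=> [i j|i]; first exact: B0 (erefl _).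
have := BA i i; rewrite !mxE eqxx (bigD1 i) //= big1 ?addr0 => [BAi|l li].
  by apply/unitrP; exists (A i i); rewrite mulrC BAi.
case: (ltngtP l i) => [/(B0 _ _ _ (erefl _))->|/A0->|/val_inj E];
  rewrite ?mul0r ?mulr0 //.
by rewrite E eqxx in li.
Qed.

Definition upper_one : T := UpperGroup is_upper_unit_mx1.
Definition upper_mul (x y : T) : T :=
  UpperGroup (is_upper_unit_mxM (valP x) (valP y)).
Definition upper_inv (x : T) : T := UpperGroup (is_upper_unit_mxV (valP x)).

Lemma upper_mulA : associative upper_mul.
Proof. by move=> x y z; apply: val_inj; apply: mulmxA. Qed.
Lemma upper_mul1 : left_id upper_one upper_mul.
Proof. by move=> x; apply: val_inj; apply: mul1mx. Qed.
Lemma upper_mulr1 : right_id upper_one upper_mul.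
Proof. by move=> x; apply: val_inj; apply: mulmx1. Qed.
Lemma upper_mulV : left_inverse upper_one upper_inv upper_mul.
Proof.
by move=> x; apply: val_inj; apply/mulVmx/is_upper_unit_mx_unit/valP.
Qed.
Lemma upper_mulrV : right_inverse upper_one upper_inv upper_mul.
Proof.
by move=> x; apply: val_inj; apply/mulmxV/is_upper_unit_mx_unit/valP.
Qed.

HB.instance Definition _ :=
  isGroup.Build T upper_mulA upper_mul1 upper_mulr1 upper_mulV upper_mulrV.

End UpperGroup.

Definition is_algint (K : fieldExtType rat) : {pred K} :=
  fun x => `[< integralOver (intr : int -> K) x >].

Record ring_of_integers (K : fieldExtType rat) := RingOfIntegers {
  algint_val :> K;
  _ : algint_val \in @is_algint K
}.

Section RingOfIntegers.
Variable K : fieldExtType rat.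
Local Notation O := (ring_of_integers K).

HB.instance Definition _ := [isSub for @algint_val K].
HB.instance Definition _ := [Choice of O by <:].

Lemma is_algint_subring : subring_closed (@is_algint K).
Proof.
split=> [|x y /asboolP Ix /asboolP Iy|x y /asboolP Ix /asboolP Iy];
  apply/asboolP; [exact: integral1 | exact: integral_sub | exact: integral_mul].
Qed.

HB.instance Definition _ :=
  GRing.SubChoice_isSubComNzRing.Build K (@is_algint K) O is_algint_subring.

(* The units are the integers whose inverse in [K] is again an integer. *)
Definition algint_unit : {pred O} :=
  fun x => (val x != 0) && ((val x)^-1 \in @is_algint K).

Definition algint_inv (x : O) : O :=
  if algint_unit x then insubd x (val x)^-1 else x.

Lemma algint_mulVx : {in algint_unit, left_inverse 1 algint_inv *%R}.
Proof.
move=> x xU; have ux : algint_unit x by [].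
have /andP[x0 Ix] := ux; apply: val_inj.
by rewrite rmorphM rmorph1 /= /algint_inv ux insubdK ?mulVf.
Qed.

Lemma algint_unitPl (x y : O) : y * x = 1 -> algint_unit x.
Proof.
move/(congr1 val); rewrite rmorphM rmorph1 /= => yx1.
have x0 : val x != 0.
  by apply: contra_eq_neq yx1 => ->; rewrite mulr0 eq_sym oner_eq0.
by rewrite /algint_unit x0 -[_^-1]mul1r -yx1 mulfK //; case: y {yx1}.
Qed.

Lemma algint_invr_out : {in [predC algint_unit], algint_inv =1 id}.
Proof. by move=> x xU; have /negbTE ux : ~~ algint_unit x by []; rewrite /algint_inv ux. Qed.

HB.instance Definition _ :=
  GRing.ComNzRing_hasMulInverse.Build O
    algint_mulVx algint_unitPl algint_invr_out.

End RingOfIntegers.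

(* The field structure on the Stdlib reals comes from [Rstruct]. *)
Definition imaginary_quadratic (K : fieldExtType rat) : Prop :=
  \dim {:K} = 2%N /\ ~ inhabited {rmorphism K -> Rdefinitions.R}.

(* Main.v *)
From HB Require Import structures.
Require Import Defs.
From mathcomp Require Import all_boot all_order all_fingroup all_algebra.
From mathcomp Require Import all_field boolp Rstruct.
From mathcomp Require Import zify ring.

(** Scalar matrices turn a positive generalized identity into a common exponent
    for the units of the base ring. Conversely, if the units have exponent [k],
    then [x ^+ k] is unipotent, and a unipotent matrix is killed row by row, from
    the bottom up, by multiplying it with its conjugate by the diagonal matrix
    that has a single entry [-1]. So the question is when the units of [O_K] have
    finite exponent.

    For [K] rational or imaginary quadratic the exponent is 12, by inspection of
    the minimal polynomial of a unit. For any other [K], write [K = Q(x)] with [x]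
    integral of degree [d] and choose a complex conjugate [w] of [x] which is real,
    or non-real with [d > 2]. Dirichlet's box principle gives nonzero [g] in [Z[X]]
    of degree less than [d] for which [g(w)] is arbitrarily small while the norm of
    [g(x)] stays bounded by some [B]. Two such elements that are congruent modulo
    [B!] have a unit as quotient, and it has infinite order because the two values
    at [w] have different absolute values. *)

Set Implicit Arguments.
Unset Strict Implicit.
Unset Printing Implicit Defensive.
Import GRing.Theory Num.Theory Order.TTheory.
Local Open Scope ring_scope.

(** * Identities in groups of triangular matrices *)

Section UpperGroupIdentity.
Variables (n : nat) (R : comUnitRingType).
Local Notation T := (upper_group n R).
Implicit Types (x y : T) (s : seq T).

(** Words are sequences of conjugators here, since the construction below concatenates them. *)
Lemma pgi_seq (G : groupType) (s : seq G) : (0 < size s)%N ->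
  (forall x : G, \prod_(h <- s) x ^ h = 1)%g -> positive_generalized_identity G.
Proof.
move=> s_gt0 sP; exists (size s), (fun i => tnth (in_tuple s) i); split=> // x.
by rewrite -[RHS](sP x) [RHS]big_tnth.
Qed.

Lemma is_upper_scalar (u : R) :
  u \is a GRing.unit -> is_upper_unit_mx (u%:M : 'M[R]_n).
Proof.
move=> uU; apply/is_upper_unit_mxP; split=> [i j ji|i]; rewrite mxE ?eqxx //.
by case: eqP ji => // ->; rewrite ltnn.
Qed.

(** A scalar matrix is central, so the identity reduces to its [k]-th power; [n > 0] provides a
    diagonal entry to compare. *)
Lemma pgi_unit_exponent : (0 < n)%N -> positive_generalized_identity T ->
  exists2 k, (0 < k)%N & forall u : R, u \is a GRing.unit -> u ^+ k = 1.
Proof.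
move=> n_gt0 [k [g [k_gt0 gP]]]; exists k => // u uU.
set x : T := UpperGroup (is_upper_scalar uU).
have xJ (h : T) : (x ^ h = x)%g.
  rewrite conjgE; apply: val_inj => /=.
  change (invmx h *m (u%:M *m h) = u%:M).
  by rewrite -scalar_mxC mulmxA mulVmx ?mul1mx //; apply/is_upper_unit_mx_unit/(valP h).
have := gP x; under eq_bigr do rewrite xJ.
rewrite big_const_ord => /(congr1 val) /matrixP /(_ (Ordinal n_gt0) (Ordinal n_gt0)).
suff -> : \val (iter k (mulg x) 1%g) = (u ^+ k)%:M by rewrite !mxE eqxx.
elim: k {k_gt0 g gP} => [//|k IH].
by rewrite iterS -[LHS]/(u%:M *m val _) IH -scalar_mxM exprS.
Qed.

(** Measures the progress of the elimination: [l = n] asks only for ones on the diagonal, [l = 0]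
    for the identity matrix. *)
Definition unipotent_below (l : nat) (A : 'M[R]_n) :=
  (forall i, A i i = 1) /\ (forall i j : 'I_n, (l <= i)%N -> A i j = (i == j)%:R).

Definition flip_mx (l : nat) : 'M[R]_n :=
  diag_mx (\row_i (if val i == l then -1 else 1)).

Lemma is_upper_flip l : is_upper_unit_mx (flip_mx l).
Proof.
apply/is_upper_unit_mxP; split=> [i j ji|i]; rewrite !mxE.
  by rewrite (_ : (i == j) = false) //; apply: contraTF ji => /eqP->; rewrite ltnn.
by rewrite eqxx; case: ifP => _; rewrite ?mulr1n ?unitrN1 ?unitr1.
Qed.

Definition flip l : T := UpperGroup (is_upper_flip l).

Lemma flip_mxK l : flip_mx l *m flip_mx l = 1%:M.
Proof.
apply/matrixP=> i j; rewrite mul_diag_mx !mxE.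
by have [->|_] := eqVneq i j; case: ifP => _; rewrite ?mulr1n ?mulr0n ?mulr0 ?mulrNN ?mulr1.
Qed.

Lemma conjg_flipE l x i j : val (x ^ flip l)%g i j =
  (if val i == l then -1 else 1) * (if val j == l then -1 else 1) * val x i j.
Proof.
have -> : val (x ^ flip l)%g = flip_mx l *m (val x *m flip_mx l).
  rewrite conjgE -[LHS]/(invmx (flip_mx l) *m (val x *m flip_mx l)).
  congr (_ *m _); rewrite -[LHS]mulmx1 -(flip_mxK l) mulmxA mulVmx ?mul1mx //.
  exact/is_upper_unit_mx_unit/is_upper_flip.
by rewrite mul_diag_mx mul_mx_diag !mxE mulrAC mulrA.
Qed.

(** Off the diagonal of row [l], the entry of the product is that of [x] plus its negative. The
    other terms vanish by triangularity and because the rows after [l] are already those of the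
    identity. *)
Lemma mul_conjg_flip l x : unipotent_below l.+1 (val x) ->
  unipotent_below l (val (x * x ^ flip l)%g).
Proof.
move=> [x1 xl]; set y := (x ^ flip l)%g.
have [x0 _] := is_upper_unit_mxP _ (valP x); have [y0 _] := is_upper_unit_mxP _ (valP y).
have mulE i j : val (x * y)%g i j = \sum_k val x i k * val y k j by rewrite [LHS]mxE.
have y1 i : val y i i = 1.
  by rewrite conjg_flipE x1 mulr1; case: ifP => _; rewrite ?mulrNN mulr1.
split=> [i|i j li].
  rewrite mulE (bigD1 i) //= x1 y1 mulr1 big1 ?addr0 // => k ki.
  case: (ltngtP k i) => [/x0->|/y0->|/val_inj E]; rewrite ?mul0r ?mulr0 //.
  by rewrite E eqxx in ki.
rewrite mulE (bigD1 i) //= x1 mul1r; move: li; rewrite leq_eqVlt => /orP[/eqP li|li].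
  have [<-|ij] := eqVneq i j.
    rewrite y1 big1 ?addr0 // => k ki.
    case: (ltngtP k i) => [/x0->|/y0->|/val_inj E]; rewrite ?mul0r ?mulr0 //.
    by rewrite E eqxx in ki.
  have jl : val j == l = false by apply/negbTE; rewrite li val_eqE eq_sym.
  have vi : val i = l by rewrite li.
  rewrite conjg_flipE vi eqxx jl mulr1 mulN1r.
  rewrite (bigD1 j) 1?eq_sym //= y1 mulr1 big1 ?addr0; last first.
    move=> k /andP[ki kj]; case: (ltngtP k i) => [/x0->|ik|/val_inj E]; rewrite ?mul0r //.
      by rewrite conjg_flipE xl ?li // (negbTE kj) !mulr0.
    by rewrite E eqxx in ki.
  by rewrite addNr.
rewrite conjg_flipE xl // big1 ?addr0; last first.
  by move=> k ki; rewrite xl // eq_sym (negbTE ki) mul0r.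
have [<-|_] := eqVneq i j; last by rewrite mulr0.
by case: ifP => _; rewrite ?mulrNN !mulr1.
Qed.

(* Each step replaces the word [y] found so far by [y * y ^ flip l]. *)
Lemma pgi_unipotent_below m l (s : seq T) : (0 < size s)%N -> (l + m = n)%N ->
  (forall x, unipotent_below n (val (\prod_(h <- s) x ^ h)%g)) ->
  exists2 s' : seq T, (0 < size s')%N &
    forall x, unipotent_below l (val (\prod_(h <- s') x ^ h)%g).
Proof.
elim: m l => [|m IH] l s_gt0 lm sP; first by exists s; rewrite // -[l]addn0 lm.
have [|s' s'_gt0 s'P] := IH l.+1 s_gt0 _ sP; first by rewrite addSnnS.
exists (s' ++ [seq (h * flip l)%g | h <- s']); first by rewrite size_cat addn_gt0 s'_gt0.
move=> x; rewrite big_cat big_map /=.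
have -> : (\prod_(h <- s') x ^ (h * flip l) = (\prod_(h <- s') x ^ h) ^ flip l)%g.
  elim: s' {s'_gt0 s'P} => [|h s' IHs]; first by rewrite !big_nil conj1g.
  by rewrite !big_cons conjMg IHs conjgM.
exact: mul_conjg_flip.
Qed.

(** The elimination starts from the word of [k] trivial conjugators: its value is the [k]-th power
    of [x], with ones on the diagonal. *)
Lemma unit_exponent_pgi k : (0 < k)%N ->
  (forall u : R, u \is a GRing.unit -> u ^+ k = 1) -> positive_generalized_identity T.
Proof.
move=> k_gt0 uk.
have [|//||s s_gt0 sP] := @pgi_unipotent_below n 0 (nseq k 1%g).
- by rewrite size_nseq.
- move=> x; split=> [i|i j]; last by rewrite leqNgt ltn_ord.
  have [x0 xU] := is_upper_unit_mxP _ (valP x).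
  rewrite -(uk _ (xU i)); elim: k {k_gt0 uk} => [|k IH].
    by rewrite big_nil expr0 mxE eqxx.
  rewrite /= big_cons conjg1 exprS -IH [LHS]mxE.
  set y := (\prod_(h <- _) _)%g; have [y0 _] := is_upper_unit_mxP _ (valP y).
  rewrite (bigD1 i) //= big1 ?addr0 // => l li.
  case: (ltngtP l i) => [/x0->|/y0->|/val_inj E]; rewrite ?mul0r ?mulr0 //.
  by rewrite E eqxx in li.
apply: (pgi_seq s_gt0) => x; apply: val_inj; apply/matrixP => i j.
by have [_ ->] := sP x; rewrite // mxE.
Qed.

End UpperGroupIdentity.

(** * Minimal polynomials over the integers *)

Lemma horner_int_map (R S : nzRingType) (s : {rmorphism R -> S}) (p : {poly int}) (a : R) :
  (map_poly intr p).[s a] = s (map_poly intr p).[a].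
Proof.
rewrite -horner_map /= -map_poly_comp; congr (_.[_]).
by apply: eq_map_poly => c /=; rewrite rmorph_int.
Qed.

Lemma monic_root2 (L : comNzRingType) (f : {poly int}) (x : L) :
  f \is monic -> size f = 2%N -> root (map_poly intr f) x -> x = (- f`_0)%:~R.
Proof.
move=> /monicP; rewrite lead_coefE => f1 f2; rewrite f2 in f1.
rewrite rootE (@horner_coef_wide _ 2); last by rewrite (leq_trans (size_poly _ _)) ?f2.
rewrite !big_ord_recr big_ord0 /= !coef_map /= f1 add0r expr0 mulr1 mul1r expr1.
by rewrite addrC addr_eq0 => /eqP->; rewrite rmorphN.
Qed.

Lemma monic_root3 (L : comNzRingType) (f : {poly int}) (x : L) :
  f \is monic -> size f = 3%N ->
  root (map_poly intr f) x <-> x ^+ 2 + (f`_1)%:~R * x + (f`_0)%:~R = 0.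
Proof.
move=> /monicP; rewrite lead_coefE => f1 f2; rewrite f2 in f1.
rewrite rootE (@horner_coef_wide _ 3); last by rewrite (leq_trans (size_poly _ _)) ?f2.
rewrite !big_ord_recr big_ord0 /= !coef_map /= f1 add0r expr0 mulr1 mul1r expr1.
by rewrite [_ + x ^+ 2]addrC [_ + _ * x]addrC addrA; split=> /eqP.
Qed.

Section MinimalPolynomial.
Variable K : fieldExtType rat.
Local Notation pZtoK := (map_poly (intr : int -> K)).
Local Notation pQtoK := (map_poly (in_alg K)).

Lemma pZtoKE (p : {poly int}) : pZtoK p = pQtoK (map_poly intr p).
Proof.
by rewrite -map_poly_comp; apply: eq_map_poly => c; rewrite [RHS](rmorph_int (in_alg K)).
Qed.

Lemma intr_fieldext_eq0 (c : int) : ((c%:~R : K) == 0) = (c == 0).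
Proof. by rewrite -(rmorph_int (in_alg K)) fmorph_eq0 intr_eq0. Qed.

Lemma intr_fieldext_inj : injective (intr : int -> K).
Proof.
by move=> a b /eqP; rewrite -subr_eq0 -rmorphB intr_fieldext_eq0 subr_eq0 => /eqP.
Qed.

(** Gauss's lemma: the minimal polynomial divides a monic integer equation of [x], so it is
    proportional to an integer factor of it. The leading coefficients of this factor and its
    cofactor have product 1, so up to sign the factor is monic. *)
Lemma minPoly_int (x : K) : integralOver (intr : int -> K) x ->
  exists2 f : {poly int}, f \is monic & pZtoK f = minPoly 1 x.
Proof.
move=> [p p_mon px0].
have /polyOver1P[q qE] := minPolyOver 1%AS x.
have q_mon : q \is monic by rewrite -(map_monic (in_alg K)) -qE monic_minPoly.
have : q %| map_poly intr p.
  rewrite -(dvdp_map (in_alg K)) -qE minPoly_dvdp -?pZtoKE //.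
  by rewrite pZtoKE; apply/polyOver1P; exists (map_poly intr p).
case/dvdpP_rat_int=> p1 [a a0 qa] [r pr].
have : lead_coef p1 * lead_coef r = 1 by rewrite -lead_coefM -pr; apply/eqP.
move=> c1; have cU : lead_coef p1 * lead_coef p1 = 1.
  by have /orP[] := intUnitRing.unitzPl (etrans (mulrC _ _) c1) => /eqP->.
exists (lead_coef p1 *: p1); first by rewrite monicE lead_coefZ cU.
rewrite qE pZtoKE; congr map_poly.
move/monicP: q_mon; rewrite qa lead_coefZ lead_coef_map_inj ?rmorph0 //; last exact: intr_inj.
rewrite linearZ /= => a1; congr (_ *: _).
by rewrite -[a]mulr1 -[X in a * X](rmorph1 intr) -cU rmorphM mulrA a1 mul1r.
Qed.

(* [c] is the leading coefficient of an integral equation for [x]. *)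
Lemma integral_scale (x : K) :
  exists2 c : int, c != 0 & integralOver (intr : int -> K) (c%:~R * x).
Proof.
have /polyOver1P[q qE] := minPolyOver 1%AS x.
have [p [a a0 qa]] := rat_poly_scale q.
have p0 : p != 0.
  apply: contraTneq (monic_minPoly 1%AS x) => p0.
  by rewrite qE qa p0 rmorph0 scaler0 rmorph0 monicE lead_coef0 eq_sym oner_eq0.
have px : (pZtoK p).[x] = 0.
  have /rootP := root_minPoly 1%AS x; rewrite qE qa map_polyZ -pZtoKE hornerZ => /eqP.
  by rewrite mulf_eq0 fmorph_eq0 invr_eq0 intr_eq0 (negbTE a0) => /eqP.
set c := lead_coef p; have c0 : c != 0 by rewrite lead_coef_eq0.
exists c => //; set d := (size p).-1.
have d1 : size p = d.+1 by rewrite prednK ?size_poly_gt0.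
have d0 : (0 < d)%N.
  rewrite lt0n; apply: contraNneq c0 => d0.
  have pC : p = c%:P.
    rewrite /c [p in RHS]size1_polyC ?lead_coefC ?d1 ?d0 //.
    by apply: size1_polyC; rewrite d1 d0.
  by move/eqP: px; rewrite pC map_polyC hornerC intr_fieldext_eq0.
(* This is [c ^ (d-1) * p(X / c)], which vanishes at [c * x]. The top coefficient is set apart
   because the truncated [d.-1 - d] would give [c] instead of 1. *)
pose r := \poly_(i < d.+1) (if i == d then 1 else p`_i * c ^+ (d.-1 - i)).
have rd : r`_d = 1 by rewrite coef_poly ltnSn eqxx.
exists r.
  by rewrite monicE lead_coef_poly ?eqxx // oner_eq0.
have cK : (c%:~R : K) != 0 by rewrite intr_fieldext_eq0.
apply/rootP/(mulfI cK); rewrite mulr0.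
have Sr : (size (pZtoK r) <= d.+1)%N by rewrite (leq_trans (size_poly _ _)) ?size_poly.
have Sp : (size (pZtoK p) <= d.+1)%N by rewrite (leq_trans (size_poly _ _)) ?d1.
rewrite (horner_coef_wide _ Sr) mulr_sumr.
transitivity (c%:~R ^+ d * (pZtoK p).[x]); last by rewrite px mulr0.
rewrite (horner_coef_wide _ Sp) mulr_sumr; apply: eq_bigr => i _.
rewrite !coef_map coef_poly ltn_ord exprMn.
have [->|id] := eqVneq (val i) d.
  by rewrite (_ : p`_d = c) ?mul1r; [rewrite mulrCA | rewrite /c lead_coefE].
have {}id : (i <= d.-1)%N.
  by rewrite -ltnS (prednK d0) ltn_neqAle id -ltnS ltn_ord.
have -> : c%:~R ^+ d = c%:~R * c%:~R ^+ (d.-1 - i) * c%:~R ^+ i :> K.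
  by rewrite -exprS -exprD addSn subnK // prednK.
rewrite /= intrM rmorphXn /= !mulrA; congr (_ * _).
by rewrite -!mulrA; congr (_ * _); rewrite mulrC mulrA.
Qed.

(** The primitive element theorem in characteristic zero gives a generator; a nonzero integer
    multiple of it is integral and generates the same field. *)
Lemma primitive_integer : exists x : K, exists f : {poly int},
  [/\ {:K}%VS = <<1; x>>%VS, f \is monic & pZtoK f = minPoly 1 x].
Proof.
have sepK : separable 1%VS {:K}%VS.
  apply/separableP=> y _; apply: pcharf0_separable; by move=> p; rewrite pchar_lalg pchar_num.
have gen := eq_adjoin_separable_generator sepK (subvf _).
set y := separable_generator _ _ in gen.
have [c c0 cy] := integral_scale y.
have [f f_mon fE] := minPoly_int cy.
exists (c%:~R * y), f; split=> //.
apply/eqP; rewrite eqEsubv subvf andbT gen.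
apply/FadjoinP; split; first exact: sub1v.
rewrite [X in X \in _](_ : y = (c%:~R : rat)^-1 *: (c%:~R * y)); last first.
  by rewrite -(rmorph_int (in_alg K)) mulr_algl scalerA mulVf ?scale1r // intr_eq0.
apply: memvZ; exact: memv_adjoin.
Qed.


Section Embedding.
Variables (x : K) (f : {poly int}) (F : numFieldType) (z : F).
Hypothesis genx : {:K}%VS = <<1; x>>%VS.
Hypothesis fE : pZtoK f = minPoly 1 x.
Hypothesis fz : root (map_poly intr f) z.
Local Notation pQtoF := (map_poly (ratr : rat -> F)).

(** The minimal polynomial of [x] divides [p - q] and vanishes at [z]. Hence sending [p(x)] to
    [p(z)] is well defined. *)
Lemma horner_root_eq (p q : {poly rat}) :
  (pQtoK p).[x] = (pQtoK q).[x] -> (pQtoF p).[z] = (pQtoF q).[z].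
Proof.
move=> pq; apply/eqP; rewrite -subr_eq0 -hornerN -hornerD -rmorphB.
have : minPoly 1 x %| pQtoK (p - q).
  apply: minPoly_dvdp; first by apply/polyOver1P; exists (p - q).
  by rewrite rootE rmorphB hornerD hornerN pq subrr.
rewrite -fE pZtoKE dvdp_map => /dvdpP[r ->].
have fF : pQtoF (map_poly intr f) = map_poly intr f.
  by rewrite -map_poly_comp; apply: eq_map_poly => c /=; rewrite ratr_int.
by rewrite rmorphM hornerM /= fF (rootP fz) mulr0.
Qed.

Lemma generator_poly (y : K) : exists p : {poly rat}, (pQtoK p).[x] = y.
Proof.
have yx : y \in <<1; x>>%VS by rewrite -genx memvf.
have /polyOver1P[p pE] := Fadjoin_polyOver 1%AS x y.
by exists p; rewrite -pE (Fadjoin_poly_eq yx).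
Qed.

(** Each element of [K] is some [p(x)], with [p] picked by choice, and is sent to [p(z)]. The
    general target [F] serves both the reals and [algC]. *)
Lemma embedding : exists s : {rmorphism K -> F}, s x = z.
Proof.
pose P (y : K) := sval (cid (generator_poly y)).
have PE y : (pQtoK (P y)).[x] = y by rewrite /P; case: cid.
pose s y := (pQtoF (P y)).[z].
have sE p : s (pQtoK p).[x] = (pQtoF p).[z] by apply: horner_root_eq; rewrite PE.
have s_add : zmod_morphism s.
  move=> a b; rewrite -{1}(PE a) -{1}(PE b) -hornerN -hornerD -rmorphB sE.
  by rewrite rmorphB hornerD hornerN.
have s_mul : monoid_morphism s.
  split=> [|a b].
    by have := sE 1; rewrite !rmorph1 !hornerC.
  by rewrite -{1}(PE a) -{1}(PE b) -hornerM -rmorphM sE rmorphM hornerM.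
pose sadd := GRing.isZmodMorphism.Build K F s s_add.
pose smul := GRing.isMonoidMorphism.Build K F s s_mul.
pose S : {rmorphism K -> F} := HB.pack s sadd smul.
by exists S; have := sE 'X; rewrite !map_polyX !hornerX.
Qed.

End Embedding.

End MinimalPolynomial.

(** * Units of the rationals and of imaginary quadratic fields *)

Section SmallFields.
Variable K : fieldExtType rat.
Local Notation pZtoK := (map_poly (intr : int -> K)).

Lemma size_minPoly_int (x : K) (f : {poly int}) :
  pZtoK f = minPoly 1 x -> size f = (adjoin_degree 1 x).+1.
Proof.
move=> fE; rewrite -size_minPoly -fE size_map_inj_poly ?rmorph0 //.
exact: intr_fieldext_inj.
Qed.

Lemma unit_integral (u : ring_of_integers K) : u \is a GRing.unit ->
  [/\ val u != 0, integralOver (intr : int -> K) (val u)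
    & integralOver (intr : int -> K) (val u)^-1].
Proof.
move=> uU; have /andP[u0 /asboolP uV] : algint_unit u by [].
split=> //.
by have /asboolP := valP u.
Qed.

(** Both minimal polynomials are linear, so [x] and its inverse are ordinary integers and [x] is [1]
    or [-1]; the exponent 12 comes from the quadratic case. *)
Lemma unit_exponent_rational (x : K) : x \in 1%VS -> x != 0 ->
  integralOver (intr : int -> K) x -> integralOver (intr : int -> K) x^-1 ->
  x ^+ 12 = 1.
Proof.
move=> x1 x0 /minPoly_int[f f_mon fE] /minPoly_int[g g_mon gE].
have deg y : y \in 1%VS -> adjoin_degree 1 y = 1%N :> nat.
  by move=> y1; apply/eqP; rewrite adjoin_deg_eq1.
have fx : x = (- f`_0)%:~R.
  by apply: monic_root2; rewrite ?(size_minPoly_int fE) ?deg // fE root_minPoly.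
have gx : x^-1 = (- g`_0)%:~R.
  by apply: monic_root2; rewrite ?(size_minPoly_int gE) ?deg ?rpredV // gE root_minPoly.
have := mulfV x0; rewrite gx fx -intrM => /eqP.
rewrite -(subr_eq0 _ 1) -[1]/(1%:~R) -intrB intr_fieldext_eq0 subr_eq0 => /eqP fg.
have /orP[] := intUnitRing.unitzPl (etrans (mulrC _ _) fg) => /eqP->.
  by rewrite expr1n.
by rewrite rmorphN -signr_odd.
Qed.

(** In the minimal polynomial [X^2 + a X + b], the norm [b] is invertible and the discriminant
    negative, so [b = 1] and [a] is 0, 1 or -1. Thus [x] is a root of unity of order 4, 3 or 6, with
    least common multiple 12. *)
Lemma unit_exponent_imaginary (x : K) : imaginary_quadratic K -> x \notin 1%VS ->
  integralOver (intr : int -> K) x -> integralOver (intr : int -> K) x^-1 ->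
  x ^+ 12 = 1.
Proof.
move=> [dimK noR] x1 /minPoly_int[f f_mon fE] /minPoly_int[g g_mon gE].
have x0 : x != 0 by apply: contraNneq x1 => ->; rewrite mem0v.
have deg y : y \notin 1%VS -> adjoin_degree 1 y = 2%N :> nat /\ {:K}%VS = <<1; y>>%VS.
  move=> y1; have dimy := dim_Fadjoin 1%AS y; rewrite dimv1 muln1 in dimy.
  have le2 : (adjoin_degree 1 y <= 2)%N by rewrite -dimy -dimK dimvS ?subvf.
  have ne1 : adjoin_degree 1 y != 1%N by rewrite adjoin_deg_eq1.
  have gt0 : (0 < adjoin_degree 1 y)%N by rewrite /adjoin_degree.
  have deg2 : adjoin_degree 1 y = 2%N :> nat.
    by move: le2 ne1 gt0; case: (adjoin_degree 1 y) => [|[|[|]]].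
  by split=> //; apply/esym/eqP; rewrite eqEdim subvf dimK dimy deg2.
have [dx genx] := deg x x1.
have [|dy _] := deg x^-1; first by rewrite rpredV.
have f3 : size f = 3%N by rewrite (size_minPoly_int fE) dx.
have g3 : size g = 3%N by rewrite (size_minPoly_int gE) dy.
have fx : root (pZtoK f) x by rewrite fE root_minPoly.
have gx : root (pZtoK g) x^-1 by rewrite gE root_minPoly.
move/(monic_root3 _ f_mon f3): fx; move/(monic_root3 _ g_mon g3): gx.
set a := f`_1; set b := f`_0; set c := g`_1; set d := g`_0 => gx fx.
(* Multiply the equation of [x^-1] by [x ^+ 2] and subtract [d] times that of [x]. As [x] is
   irrational, both coefficients of this relation vanish. *)
have lin : (c - d * a)%:~R * x + (1 - d * b)%:~R = 0.
  transitivity (x ^+ 2 * (x^-1 ^+ 2 + c%:~R * x^-1 + d%:~R)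
                - d%:~R * (x ^+ 2 + a%:~R * x + b%:~R)).
    by rewrite !rmorphB !rmorphM /=; field.
  by rewrite gx fx !mulr0 subr0.
have cda : c - d * a = 0.
  apply/eqP; rewrite -(intr_fieldext_eq0 K); apply: contraNT x1 => n0.
  have -> : x = ((- (1 - d * b)%:~R / (c - d * a)%:~R) : rat)%:A.
    rewrite -in_algE rmorphM fmorphV rmorphN !rmorph_int; apply: (canRL (mulfK n0)).
    by rewrite mulrC; apply/eqP; rewrite -addr_eq0 lin.
  exact/memvZ/mem1v.
have db : d * b = 1.
  move/eqP: lin; rewrite cda mul0r add0r intr_fieldext_eq0 subr_eq0 => /eqP <- //.
(* Otherwise the quadratic formula yields a real root of [f], hence an embedding of [K] into the
   reals. *)
have disc : a ^+ 2 < 4 * b.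
  rewrite ltNge; apply/negP => D0; apply: noR.
  pose D : Rdefinitions.R := (a ^+ 2 - 4 * b)%:~R.
  pose z := (- a%:~R + Num.sqrt D) / 2.
  have [|s _] := @embedding K x f Rdefinitions.R z genx fE; last by constructor.
  apply/(monic_root3 _ f_mon f3).
  have D2 : Num.sqrt D ^+ 2 = D by rewrite sqr_sqrtr // ler0z subr_ge0.
  transitivity ((Num.sqrt D ^+ 2 - D) / 4); last by rewrite D2 subrr mul0r.
  by rewrite /z /D rmorphB rmorphXn rmorphM /=; field.
have b1 : b = 1.
  have /orP[/eqP->//|/eqP bN] := intUnitRing.unitzPl db.
  by move: disc; rewrite bN ltNge (le_trans _ (sqr_ge0 a)).
have : a = 0 \/ a = 1 \/ a = -1.
  move: disc; rewrite b1 expr2 => disc.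
  have : -2 < a < 2 by apply/andP; split; nia.
  lia.

move: fx; rewrite b1 => fx aE; apply/eqP; rewrite -subr_eq0.
(* The three equations are the cyclotomic polynomials of orders 4, 3 and 6, each a factor of
   [x ^+ 12 - 1]. *)
case: aE => [aE|[aE|aE]]; rewrite aE in fx.
- rewrite [X in X == _](_ : _ = (x ^+ 2 + 0%:~R * x + 1%:~R) *
    ((x ^+ 2 - 1) * (x ^+ 8 + x ^+ 4 + 1))); last by ring.
  by rewrite fx mul0r.
- rewrite [X in X == _](_ : _ = (x ^+ 2 + 1%:~R * x + 1%:~R) *
    ((x - 1) * (x ^+ 3 + 1) * (x ^+ 6 + 1))); last by ring.
  by rewrite fx mul0r.
- rewrite [X in X == _](_ : _ = (x ^+ 2 + (-1)%:~R * x + 1%:~R) *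
    ((x + 1) * (x ^+ 3 - 1) * (x ^+ 6 + 1))); last by ring.
  by rewrite fx mul0r.
Qed.

Lemma unit_exponent12 (u : ring_of_integers K) :
  ({:K} = 1)%VS \/ imaginary_quadratic K -> u \is a GRing.unit -> u ^+ 12 = 1.
Proof.
move=> K12 /unit_integral[u0 ui uvi]; apply: val_inj; rewrite rmorphXn rmorph1.
have [u1|u1] := boolP (val u \in 1%VS); first exact: unit_exponent_rational.
case: K12 => [K1|K2]; first by rewrite -K1 memvf in u1.
exact: unit_exponent_imaginary.
Qed.
End SmallFields.

(** * Norms and Dirichlet approximation *)

Section Norm.
Import Pdiv.CommonRing Pdiv.RingMonic.
Variables (d : nat) (f g : {poly int}).
Hypotheses (f_mon : f \is monic) (fd : size f = d.+2).
Local Notation ev p a := (map_poly intr p).[a].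

(* Multiplication by [g] on the basis [1, 'X, ..., 'X^d] of [Z['X] / f]. *)
Definition mult_mx : 'M[int]_d.+1 := \matrix_(i, j) (rmodp ('X^i * g) f)`_j.

(** Reduction modulo [f] preserves values at a root, so the powers of [a] form an eigenvector of
    [mult_mx] with eigenvalue [g(a)]. *)
Lemma mult_mxE (L : comNzRingType) (a : L) (i : 'I_d.+1) : root (map_poly intr f) a ->
  \sum_j (mult_mx i j)%:~R * a ^+ j = a ^+ i * ev g a.
Proof.
move=> /rootP fa.
have := congr1 (fun p => ev p a) (rdivp_eq f_mon ('X^i * g)).
rewrite rmorphD !rmorphM /= hornerD !hornerM fa mulr0 add0r map_polyXn hornerXn => ->.
have sz : (size (rmodp ('X^i * g) f) <= d.+1)%N.
  by rewrite -ltnS -fd ltn_rmodp monic_neq0.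
rewrite (@horner_coef_wide _ d.+1) ?(leq_trans (size_poly _ _)) //.
by apply: eq_bigr => j _; rewrite coef_map mxE.
Qed.

Definition int_norm : int := \det mult_mx.
Definition conorm : {poly int} := \poly_(i < d.+1) (\adj mult_mx) ord0 (inord i).

(** This is the first row of adjugate times matrix, applied to the vector of powers of [a], whose
    first entry is 1. *)
Lemma int_normE (L : comNzRingType) (a : L) :
  root (map_poly intr f) a -> int_norm%:~R = ev conorm a * ev g a.
Proof.
move=> fa.
rewrite (@horner_coef_wide _ d.+1); last by rewrite (leq_trans (size_poly _ _)) ?size_poly.
rewrite mulr_suml.
transitivity (\sum_(i < d.+1) (\adj mult_mx ord0 i)%:~R * (\sum_j (mult_mx i j)%:~R * a ^+ j)).
  under eq_bigr do rewrite mulr_sumr.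
  rewrite exchange_big /= (bigD1 ord0) //= [X in _ + X]big1 => [|j j0].
    rewrite addr0 -[LHS]mulr1 /int_norm.
    have := mul_adj_mx mult_mx => /matrixP/(_ ord0 ord0); rewrite !mxE eqxx mulr1n => <-.
    rewrite rmorph_sum mulr_suml; apply: eq_bigr => i _.
    by rewrite rmorphM expr0 !mulr1.
  have := mul_adj_mx mult_mx => /matrixP/(_ ord0 j); rewrite !mxE eq_sym (negbTE j0) mulr0n.
  move/(congr1 (fun c : int => c%:~R * a ^+ j)); rewrite mul0r => jE.
  by rewrite -[RHS]jE rmorph_sum mulr_suml; apply: eq_bigr => i _; rewrite rmorphM mulrA.
apply: eq_bigr => i _; rewrite (mult_mxE _ fa) mulrA; congr (_ * _ * _).
by rewrite coef_map coef_poly ltn_ord inord_val.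
Qed.

(** The eigenvectors of the distinct roots form an invertible Vandermonde matrix, which diagonalizes
    [mult_mx]. *)
Lemma int_norm_prod (z : seq algC) : uniq z -> map_poly intr f = \prod_(a <- z) ('X - a%:P) ->
  int_norm%:~R = \prod_(a <- z) ev g a.
Proof.
move=> z_uniq fE.
have sz : size z = d.+1.
  apply: succn_inj; rewrite -(size_prod_XsubC z id) -fE -fd size_map_inj_poly ?rmorph0 //.
  exact: intr_inj.
have zroot a : a \in z -> root (map_poly intr f) a by rewrite fE root_prod_XsubC.
pose r : 'rV[algC]_d.+1 := \row_i z`_i.
pose V := Vandermonde d.+1 r.
have V0 : \det V != 0.
  rewrite det_Vandermonde; apply/prodf_neq0 => i _; apply/prodf_neq0 => j ij.
  by rewrite !mxE subr_eq0 nth_uniq ?sz ?ltn_ord // neq_ltn ij orbT.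
have AV : map_mx intr mult_mx *m V = V *m diag_mx (\row_i ev g (r 0 i)).
  apply/matrixP=> i k; rewrite mul_mx_diag !mxE.
  rewrite -(@mult_mxE _ z`_k); last by rewrite zroot // mem_nth ?sz ?ltn_ord.
  by apply: eq_bigr => j _; rewrite !mxE.
have := congr1 determinant AV; rewrite !det_mulmx det_diag mulrC => /(mulfI V0).
rewrite det_map_mx => ->.
rewrite [RHS](big_nth 0) sz big_mkord.
by apply: eq_bigr => i _; rewrite !mxE.
Qed.

End Norm.

Section Approximation.
Local Notation ev p a := (map_poly intr p).[a].

Lemma cell_exists (M : algC) (t : nat) : 0 <= M -> (0 < t)%N ->
  exists c : algC -> 'I_t, forall r s : algC, r \is Num.real -> s \is Num.real ->
    `|r| <= M -> `|s| <= M -> c r = c s -> `|r - s| * t%:R <= 2 * M + 1.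
Proof.
(* The summand 1 keeps [D] positive when [M = 0], and keeps the scaled coordinate of the endpoint
   [M] strictly below the number of cells. *)
case: t => // t M0 _; set D := 2 * M + 1.
have D0 : 0 < D by rewrite ltr_wpDl // mulr_ge0.
pose x r := (r + M) * t.+1%:R / D.
have xP r : r \is Num.real -> `|r| <= M -> 0 <= x r < t.+1%:R.
  move=> rR; rewrite real_ler_norml // => /andP[r1 r2].
  rewrite divr_ge0 ?mulr_ge0 ?(ltW D0) //=; last by rewrite -lerBlDr sub0r.
  rewrite ltr_pdivrMr // mulrC ltr_pM2l ?ltr0Sn // (le_lt_trans (lerD r2 (lexx M))) //.
  by rewrite /D mulr_natl mulr2n ltrDl.
exists (fun r => inord (Num.trunc (x r))) => r s rR sR rM sM.
move/(congr1 val) => /=; have /andP[r0 rt] := xP r rR rM; have /andP[s0 st] := xP s sR sM.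
rewrite !inordK ?truncn_lt_nat // => rs.
have := truncn_itv r0; have := truncn_itv s0; rewrite -rs.
set k := Num.trunc _ => /andP[s1 s2] /andP[r1 r2].
have xrs : `|x r - x s| <= 1.
  rewrite real_ler_norml ?rpredB ?ger0_real // !lerBlDr lerNl opprB lerBlDr; apply/andP; split.
    by rewrite (le_trans (ltW s2)) // -natr1 addrC lerD2l.
  by rewrite (le_trans (ltW r2)) // -natr1 addrC lerD2l.
have -> : `|r - s| * t.+1%:R = `|x r - x s| * D.
  rewrite -[D in RHS](gtr0_norm D0) -[t.+1%:R in LHS]normr_nat -!normrM; congr `|_|.
  by rewrite /x -!mulrBl opprD addrACA subrr addr0 divfK ?gt_eqF.
by rewrite -[leRHS]mul1r ler_pM2r.
Qed.

Lemma horner_int_le (d Q : nat) (g : {poly int}) (a : algC) :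
  (size g <= d)%N -> (forall i, `|g`_i| <= Q%:Z) ->
  `|ev g a| <= (\sum_(i < d) `|a| ^+ i) * Q%:R.
Proof.
move=> gd gQ; rewrite (@horner_coef_wide _ d) ?(leq_trans (size_poly _ _)) //.
rewrite (le_trans (ler_norm_sum _ _ _)) // mulr_suml ler_sum // => i _.
rewrite coef_map normrM normrX mulrC ler_wpM2l ?exprn_ge0 //=.
by rewrite -intr_norm -[Q%:R]/(Q%:Z%:~R) ler_int.
Qed.

(** Box principle on the [Q.+1 ^ d] polynomials with coefficients from 0 to [Q]: values at a real
    [w] need [t] cells, while in general real and imaginary parts need [t * t]. The outer factor 2
    adds the errors of the two parts. *)
Lemma small_value (d Q t : nat) (w : algC) : (0 < t)%N ->
  (w \is Num.real /\ (t < Q.+1 ^ d)%N) \/ (t * t < Q.+1 ^ d)%N ->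
  exists g : {poly int}, [/\ g != 0, (size g <= d)%N, forall i, `|g`_i| <= Q%:Z &
    `|ev g w| * t%:R <= 2 * (2 * ((\sum_(i < d) `|w| ^+ i) * Q%:R) + 1)].
Proof.
move=> t0 H; set M := (\sum_(i < d) _) * _.
have M0 : 0 <= M by rewrite mulr_ge0 ?sumr_ge0 // => i _; rewrite exprn_ge0.
have [c cP] := cell_exists M0 t0.
pose P (x : {ffun 'I_d -> 'I_Q.+1}) : {poly int} :=
  \poly_(i < d) (if insub i is Some j then (x j : nat)%:Z else 0).
have Pc x (i : 'I_d) : (P x)`_i = (x i)%:Z.
  by rewrite coef_poly ltn_ord insubT //= => ?; congr (Posz (x _)); apply: val_inj.
have Psz x : (size (P x) <= d)%N by exact: size_poly.
have PQ x i : `|(P x)`_i| <= Q%:Z.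
  case: (ltnP i d) => [id|di]; last by rewrite nth_default ?normr0 // (leq_trans (Psz x)).
  by rewrite (Pc x (Ordinal id)) ger0_norm // lez_nat -ltnS.
have PM x : `|ev (P x) w| <= M by exact: horner_int_le.
have : exists x y : {ffun 'I_d -> 'I_Q.+1}, [/\ x != y,
    c ('Re (ev (P x) w)) = c ('Re (ev (P y) w)) &
    c ('Im (ev (P x) w)) = c ('Im (ev (P y) w))].
  case: H => [[wR tQ]|tQ].
    pose F x := c ('Re (ev (P x) w)).
    have : ~~ injectiveb F.
      apply/injectiveP => /leq_card; rewrite card_ffun !card_ord leqNgt tQ //.
    case/injectivePn => x [y xy Fxy]; exists x, y; split=> //.
    have im0 x' : 'Im (ev (P x') w) = 0.
      apply/Creal_ImP; rewrite rpred_horner //; apply/polyOverP => i.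
      by rewrite coef_map /= Rreal_int ?intr_int.
    by rewrite !im0.
  pose F x := (c ('Re (ev (P x) w)), c ('Im (ev (P x) w))).
  have : ~~ injectiveb F.
    by apply/injectiveP => /leq_card; rewrite card_ffun card_prod !card_ord leqNgt tQ.
  by case/injectivePn => x [y xy [F1 F2]]; exists x, y.
case=> x [y [xy F1 F2]]; exists (P x - P y); split.
- apply: contraNneq xy => /eqP; rewrite subr_eq0 => /eqP Pxy.
  by apply/eqP/ffunP => i; apply/val_inj; have := Pc x i; rewrite Pxy Pc => -[].
- by rewrite (leq_trans (size_polyD _ _)) // size_polyN geq_max !Psz.
- move=> i; rewrite coefB; have := PQ x i; have := PQ y i.
  have P0 x' : 0 <= (P x')`_i by rewrite coef_poly; case: ifP => // _; case: insub.
  have := P0 x; have := P0 y; move: (P x)`_i (P y)`_i => p q q0 p0.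
  by rewrite (ger0_norm q0) (ger0_norm p0) ler_norml => qQ pQ; apply/andP; split; lia.
rewrite rmorphB hornerD hornerN; set u := ev (P x) w; set v := ev (P y) w.
have norm_re (a : algC) : `|a| <= M -> `|'Re a| <= M.
  by apply: le_trans; rewrite leif_normC_Re_Creal.
have norm_im (a : algC) : `|a| <= M -> `|'Im a| <= M.
  apply: le_trans; rewrite -ler_sqr ?nnegrE //.
  by rewrite real_normK ?Creal_Im // normC2_Re_Im lerDr real_exprn_even_ge0 ?Creal_Re.
have := lerD (cP _ _ (Creal_Re _) (Creal_Re _) (norm_re _ (PM x)) (norm_re _ (PM y)) F1)
             (cP _ _ (Creal_Im _) (Creal_Im _) (norm_im _ (PM x)) (norm_im _ (PM y)) F2).
rewrite -mulrDl [2 * (_ + 1)]mulr_natl mulr2n; apply: le_trans.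
rewrite ler_wpM2r // [u]Crect [v in leLHS]Crect.
rewrite opprD addrACA -mulrBr (le_trans (ler_normD _ _)) // lerD2l.
by rewrite normrM normCi mul1r.
Qed.

Lemma prod_norm_le (r : seq algC) (g : {poly int}) (X : algC) :
  (forall a, a \in r -> `|ev g a| <= X) -> \prod_(a <- r) `|ev g a| <= X ^+ size r.
Proof.
elim: r => [|a r IH] H; first by rewrite big_nil.
rewrite big_cons exprS ler_pM ?prodr_ge0 ?H ?mem_head // IH // => b br.
by rewrite H // inE br orbT.
Qed.

Lemma horner_int_conj (g : {poly int}) (a : algC) : ev g a^* = (ev g a)^*.
Proof. exact: (horner_int_map Num.conj). Qed.

(* Coefficients are taken up to [m ^ 2], with [m ^ (2 * d)] cells on the real line
   and [m ^ d] cells per axis in the plane. *)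
Lemma bounded_norm_approx (d : nat) (w : algC) (z : seq algC) :
  size z = d -> w \in z -> w^* \in z ->
  (w \is Num.real /\ (1 < d)%N) \/ (w \isn't Num.real /\ (2 < d)%N) ->
  exists (B : nat) (C : algC), forall m, (0 < m)%N -> exists g : {poly int},
    [/\ g != 0, (size g <= d)%N, `|ev g w| * m%:R <= C
      & \prod_(a <- z) `|ev g a| <= B%:R].
Proof.
move=> sz wz wcz wd; set S := 1 + \sum_(a <- z) \sum_(i < d) `|a| ^+ i.
have sum0 (a : algC) : 0 <= \sum_(i < d) `|a| ^+ i.
  by rewrite sumr_ge0 // => i _; rewrite exprn_ge0.
have S1 : 1 <= S by rewrite lerDl sumr_ge0.
have S0 : 0 <= S by rewrite (le_trans _ S1).
have zS a : a \in z -> \sum_(i < d) `|a| ^+ i <= S.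
  move=> az; rewrite /S (big_rem a) //= addrCA lerDl addr_ge0 ?ler01 //.
  by rewrite sumr_ge0.
(* The box principle gives [2 * (2 * X + 1)] with [X <= S * m ^ 2], and [1 <= S * m ^ 2] turns this
   into [6 * S * m ^ 2]. *)
pose C := 6 * S; have C0 : 0 <= C by rewrite mulr_ge0.
have approx m t : (0 < m)%N -> (0 < t)%N ->
    (w \is Num.real /\ (t < (m ^ 2).+1 ^ d)%N) \/ (t * t < (m ^ 2).+1 ^ d)%N ->
    exists g : {poly int}, [/\ g != 0, (size g <= d)%N,
      `|ev g w| * t%:R <= C * m%:R ^+ 2 &
      forall a, a \in z -> `|ev g a| <= S * m%:R ^+ 2].
  move=> m0 t0 wt; have [g [g0 gd gQ gw]] := small_value t0 wt; exists g; split=> //.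
    rewrite (le_trans gw) //.
    have m1 : 1 <= m%:R ^+ 2 :> algC by rewrite exprn_ege1 ?ler1n.
    have X1 : 1 <= S * m%:R ^+ 2 by rewrite -[leLHS]mulr1 ler_pM.
    have XS : (\sum_(i < d) `|w| ^+ i) * (m ^ 2)%:R <= S * m%:R ^+ 2.
      by rewrite natrX ler_wpM2r ?zS ?exprn_ge0.
    have -> : C * m%:R ^+ 2 = 2 * (2 * (S * m%:R ^+ 2) + S * m%:R ^+ 2) by rewrite /C; ring.
    by rewrite ler_wpM2l // lerD // ler_wpM2l.
  move=> a az; rewrite (le_trans (horner_int_le a gd gQ)) // natrX.
  by rewrite ler_wpM2r ?zS ?exprn_ge0.
have sq_lt m : (0 < m)%N -> ((m ^ 2) ^ d < (m ^ 2).+1 ^ d)%N.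
  by move=> m0; rewrite ltn_exp2r //; case: wd => -[_]; lia.
case: wd => -[wR d2].
  have [e de] : exists e, d = e.+2 by exists d.-2; lia.
  (* With [t = m ^ (2 * d)] the value at [w] is at most [C / m ^ (2 * (d - 1))], which offsets the
     bounds [S * m ^ 2] on the other [d - 1 = e.+1] factors. *)
  exists (Num.Def.archi_bound (C * S ^+ e.+1)), C => m m0.
  have [||g [g0 gd gw gz]] := approx m ((m ^ 2) ^ d)%N m0; first by rewrite !expn_gt0 m0.
    by left; split=> //; exact: sq_lt.
  have M0 : 0 < m%:R ^+ 2 :> algC by rewrite exprn_gt0 ?ltr0n.
  have {}gw : `|ev g w| * (m%:R ^+ 2) ^+ e.+1 <= C.
    by move: gw; rewrite de !natrX exprSr mulrA ler_pM2r.
  exists g; split=> //.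
    rewrite (le_trans _ gw) // ler_wpM2l // -!natrX ler_nat -expnM.
    by rewrite -{1}(expn1 m) leq_pexp2l.
  rewrite (big_rem w) //= (le_trans _ (ltW (archi_boundP _))) ?mulr_ge0 ?exprn_ge0 //.
  rewrite (le_trans (ler_wpM2l _ (@prod_norm_le _ _ (S * m%:R ^+ 2) _))) //.
    by move=> a /mem_rem /gz.
  rewrite size_rem // sz de /= exprMn mulrCA [leRHS]mulrC.
  by rewrite ler_wpM2l ?exprn_ge0.
have [e de] : exists e, d = e.+3 by exists (d - 3)%N; lia.
(* With [t = m ^ d] the value at [w] is at most [C / m ^ (d - 2)], small because [d > 2]. The
   conjugate pair contributes its square, which offsets the other [d - 2 = e.+1] factors. *)
exists (Num.Def.archi_bound (C ^+ 2 * S ^+ e.+1)), C => m m0.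
have [||g [g0 gd gw gz]] := approx m (m ^ d)%N m0; first by rewrite !expn_gt0 m0.
  by right; rewrite -expnMn -mulnn in sq_lt *; exact: sq_lt.
have M0 : 0 < m%:R ^+ 2 :> algC by rewrite exprn_gt0 ?ltr0n.
have {}gw : `|ev g w| * m%:R ^+ e.+1 <= C.
  move: gw; rewrite de natrX (_ : e.+3 = e.+1 + 2)%N; [rewrite exprD|by rewrite addn2].
  by rewrite mulrA ler_pM2r.
exists g; split=> //.
  rewrite (le_trans _ gw) // ler_wpM2l // -!natrX ler_nat.
  by rewrite -{1}(expn1 m) leq_pexp2l.
have wcr : w^* \in rem w z.
  move: wcz; rewrite (perm_mem (perm_to_rem wz)) inE => /orP[/eqP wc|//].
  by move: wR; rewrite CrealE wc eqxx.
rewrite (big_rem w) //= (big_rem w^*) //= horner_int_conj norm_conjC mulrA -expr2.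
rewrite (le_trans _ (ltW (archi_boundP _))) ?mulr_ge0 ?exprn_ge0 //.
rewrite (le_trans (ler_wpM2l _ (@prod_norm_le _ _ (S * m%:R ^+ 2) _))) ?exprn_ge0 //.
  by move=> a /mem_rem /mem_rem /gz.
rewrite !size_rem // sz de /= exprMn mulrCA [leRHS]mulrC.
rewrite ler_wpM2l ?exprn_ge0 // -exprM mulnC exprM -exprMn.
by rewrite lerXn2r ?nnegrE ?mulr_ge0 ?exprn_ge0.
Qed.

End Approximation.

(** * Units of infinite order *)

Section NontorsionUnit.
Variables (K : fieldExtType rat) (x : K) (f : {poly int}).
Hypotheses (genx : {:K}%VS = <<1; x>>%VS) (f_mon : f \is monic).
Local Notation pZtoK := (map_poly (intr : int -> K)).
Hypothesis fE : pZtoK f = minPoly 1 x.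
Local Notation ev p a := (map_poly intr p).[a].

Lemma integral_ev (p : {poly int}) : integralOver (intr : int -> K) (pZtoK p).[x].
Proof.
have xi : integralOver (intr : int -> K) x by exists f; rewrite // fE root_minPoly.
rewrite horner_coef; apply: (big_ind (integralOver (intr : int -> K))).
- exact: integral0.
- exact: integral_add.
move=> i _; rewrite coef_map; apply: integral_mul; first exact: integral_id.
elim: (nat_of_ord i) => [|j IH]; first exact: integral1.
by rewrite exprS; apply: integral_mul.
Qed.

(** The degree is below that of the minimal polynomial, so [g] cannot vanish at [x]; the injective
    embedding sending [x] to [w] carries this over to [w]. *)
Lemma ev_neq0 (g : {poly int}) (w : algC) : root (map_poly intr f) w ->
  g != 0 -> (size g < size f)%N -> (pZtoK g).[x] != 0 /\ ev g w != 0.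
Proof.
move=> fw g0 gf.
have gx : (pZtoK g).[x] != 0.
  rewrite -rootE (@root_small_adjoin_poly _ _ 1%AS).
  - by rewrite map_poly_eq0_id0 // intr_fieldext_eq0 lead_coef_eq0.
  - by rewrite pZtoKE; apply/polyOver1P; exists (map_poly intr g).
  rewrite size_map_inj_poly ?rmorph0 //; last exact: intr_fieldext_inj.
  by rewrite -ltnS -(size_minPoly_int fE).
split=> //; have [s sx] := embedding genx fE fw.
by rewrite -sx horner_int_map fmorph_eq0.
Qed.

(** In characteristic zero the minimal polynomial is separable. *)
Lemma uniq_roots_int (z : seq algC) :
  map_poly intr f = \prod_(a <- z) ('X - a%:P) -> uniq z.
Proof.
move=> fz; rewrite -separable_prod_XsubC -fz.
have -> : map_poly intr f = map_poly (ratr : rat -> algC) (map_poly intr f).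
  by rewrite -map_poly_comp; apply: eq_map_poly => c /=; rewrite ratr_int.
rewrite separable_map -(separable_map (in_alg K)) -pZtoKE fE.
by apply: (pcharf0_separable 1%AS) => p; rewrite pchar_lalg pchar_num.
Qed.

Lemma unit_of_integral (u v : K) : u * v = 1 -> integralOver (intr : int -> K) u ->
  integralOver (intr : int -> K) v ->
  exists2 a : ring_of_integers K, a \is a GRing.unit & val a = u.
Proof.
move=> uv ui vi; have uI : u \in @is_algint K by apply/asboolP.
have vI : v \in @is_algint K by apply/asboolP.
exists (RingOfIntegers uI) => //; apply/unitrP; exists (RingOfIntegers vI).
by split; apply: val_inj; rewrite rmorphM /= // mulrC.
Qed.

Lemma nontorsion_unit (w : algC) (d : nat) : size f = d.+1 -> root (map_poly intr f) w ->
  (w \is Num.real /\ (1 < d)%N) \/ (w \isn't Num.real /\ (2 < d)%N) ->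
  forall k, (0 < k)%N -> exists2 u : ring_of_integers K, u \is a GRing.unit & u ^+ k != 1.
Proof.
move=> fd fw wd k k0.
have [z fz] := closed_field_poly_normal (map_poly (intr : int -> algC) f).
have lf : lead_coef (map_poly (intr : int -> algC) f) = 1.
  by rewrite lead_coef_map_inj ?rmorph0 ?(monicP f_mon) //; apply: intr_inj.
rewrite lf scale1r in fz.
have z_uniq := uniq_roots_int fz.
have sz : size z = d.
  apply: succn_inj; rewrite -(size_prod_XsubC z id) -fz -fd size_map_inj_poly ?rmorph0 //.
  exact: intr_inj.
have wz : w \in z by rewrite -root_prod_XsubC -fz.
have wcz : w^* \in z.
  by rewrite -root_prod_XsubC -fz rootE horner_int_conj (rootP fw) rmorph0.
have [B [C approx]] := bounded_norm_approx sz wz wcz wd.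
have [e de] : exists e, d = e.+1 by exists d.-1; case: wd => -[_]; lia.
have fe : size f = e.+2 by rewrite fd de.
pose good (g : {poly int}) :=
  [/\ g != 0, (size g <= d)%N & \prod_(a <- z) `|ev g a| <= B%:R].
have good_neq0 g (a : algC) : good g -> root (map_poly intr f) a ->
    (pZtoK g).[x] != 0 /\ ev g a != 0.
  by move=> [g0 gd _] fa; apply: ev_neq0; rewrite // fd ltnS.
(* As [g] does not vanish at [w], an approximation with [m] above [C / |g(w)|] is strictly smaller
   there. *)
have next g : good g -> exists h, good h /\ `|ev h w| < `|ev g w|.
  move=> gg; have [_ gw] := good_neq0 g w gg fw.
  have gw0 : 0 < `|ev g w| by rewrite normr_gt0.
  have C0 : 0 <= C.
    by have [//|h [_ _ + _]] := approx 1%N; apply: le_trans; rewrite mulr_ge0.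
  pose m := (Num.Def.archi_bound (C / `|ev g w|)).+1.
  have [//|h [h0 hd hw hB]] := approx m.
  exists h; split=> //; rewrite -(@ltr_pM2r _ m%:R) ?ltr0n // (le_lt_trans hw) //.
  rewrite -ltr_pdivrMl // mulrC (lt_trans (archi_boundP _)) ?divr_ge0 ?(ltW gw0) //.
  by rewrite ltr_nat.
have [g0 gg0] : exists g, good g.
  by have [//|h [h0 hd _ hB]] := approx 1%N; exists h.
pose T := {g | good g}.
pose nxt (g : T) : T :=
  let h := cid (next (sval g) (svalP g)) in exist _ (sval h) (svalP h).1.
pose s i : {poly int} := sval (iter i nxt (exist _ g0 gg0)).
have sg i : good (s i) by apply: svalP.
have s_lt i : `|ev (s i.+1) w| < `|ev (s i) w|.
  by rewrite /s /= {1}/nxt /=; case: cid => /= h [].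
have s_anti i j : (i < j)%N -> `|ev (s j) w| < `|ev (s i) w|.
  elim: j => // j IH; rewrite ltnS leq_eqVlt => /orP[/eqP->//|ij].
  exact: lt_trans (s_lt j) (IH ij).
(* The norm is the product of the values at the roots, none of them zero, so its absolute value lies
   between 1 and [B]. *)
have norm_dvd h : good h -> exists q, (B`!)%:Z = q * int_norm e f h.
  move=> gh; have [_ _ hB] := gh.
  have nE := @int_norm_prod e f h f_mon fe z z_uniq fz.
  suff nB : (0 < `|int_norm e f h|%N <= B)%N.
    have /dvdnP[q qE] := dvdn_fact nB.
    exists (q%:Z * sgz (int_norm e f h)).
    by rewrite -mulrA -abszEsg qE PoszM.
  apply/andP; split.
    rewrite absz_gt0 -(intr_eq0 algC) nE prodf_seq_neq0; apply/allP => a az /=.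
    by have [] := good_neq0 h a gh; rewrite // fz root_prod_XsubC.
  rewrite -(ler_nat algC) (le_trans _ hB) // -normr_prod -nE -intr_norm.
  by rewrite -abszE.
(* At [x] the norm of [h] is [conorm * h], and it divides [B!] with quotient [q]; so [g / h] is the
   value of the integer polynomial [1 + q * conorm * b]. *)
have ratio_integral g h b : good h -> g - h = (B`!)%:Z *: b ->
    integralOver (intr : int -> K) ((pZtoK g).[x] / (pZtoK h).[x]).
  move=> gh ghb; have fx : root (pZtoK f) x by rewrite fE root_minPoly.
  have [hx _] := good_neq0 h w gh fw; have [q qE] := norm_dvd h gh.
  have nE := int_normE h f_mon fe fx.
  have -> : (pZtoK g).[x] / (pZtoK h).[x] = (pZtoK (1 + q *: (conorm e f h * b))).[x].
    apply: (mulIf hx); rewrite divfK //.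
    have -> : g = h + q *: (int_norm e f h *: b) by rewrite scalerA -qE -ghb addrC subrK.
    rewrite -!mul_polyC !rmorphD !rmorphM /= !hornerD !hornerM !map_polyC !hornerC.
    by rewrite /= nE; ring.
  exact: integral_ev.
have [L BL] : exists L, B`! = L.+1 by exists (B`!).-1; rewrite prednK ?fact_gt0.
(* Coefficients modulo [B! = L.+1] give [L.+1 ^ d] classes, one fewer than there are indices. *)
pose cl (i : 'I_(L.+1 ^ d).+1) : {ffun 'I_d -> 'I_L.+1} :=
  [ffun l : 'I_d => inord `|((s i)`_l %% L.+1%:Z)%Z|%N].
have : ~~ injectiveb cl.
  by apply/injectiveP => /leq_card; rewrite card_ffun !card_ord ltnn.
case/injectivePn => i [j ij clij].
have sij l : (L.+1%:Z %| (s i)`_l - (s j)`_l)%Z.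
  have [ld|dl] := ltnP l d; last first.
    have [[_ si _] [_ sj _]] := (sg i, sg j).
    by rewrite !nth_default ?(leq_trans si) ?(leq_trans sj) // subrr dvdz0.
  have /ffunP/(_ (Ordinal ld)) := clij; rewrite !ffunE => /(congr1 val) /=.
  have modL (c : int) : (`|(c %% L.+1%:Z)%Z| < L.+1)%N.
    by rewrite -ltz_nat gez0_abs ?modz_ge0 // ltz_pmod.
  rewrite !inordK // => /(congr1 Posz); rewrite !gez0_abs ?modz_ge0 // => sm.
  by rewrite -eqz_mod_dvd; apply/eqP.
pose b := \poly_(l < d) (((s i)`_l - (s j)`_l) %/ L.+1%:Z)%Z.
have bE : s i - s j = (B`!)%:Z *: b.
  apply/polyP => l; rewrite coefZ coefB coef_poly BL.
  case: ltnP => [_|dl]; first by rewrite mulrC divzK.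
  have [[_ si _] [_ sj _]] := (sg i, sg j).
  by rewrite !nth_default ?(leq_trans si) ?(leq_trans sj) // subrr mulr0.
have bE' : s j - s i = (B`!)%:Z *: - b by rewrite scalerN -bE opprB.
have uI := ratio_integral _ _ _ (sg j) bE; have vI := ratio_integral _ _ _ (sg i) bE'.
have [[xi _] [xj _]] := (good_neq0 _ w (sg i) fw, good_neq0 _ w (sg j) fw).
have [|u uU uE] := unit_of_integral _ uI vI; first by rewrite mulrA divfK ?divff.
exists u => //; apply: contra ij => /eqP/(congr1 val).
rewrite rmorphXn rmorph1 /= uE expr_div_n => /(canRL (mulfVK (expf_neq0 k xj))).
(* If the [k]-th power of the unit were 1, applying the embedding would give equal absolute values
   at [w] for two distinct indices, against the strict decrease. *)
have [t tx] := embedding genx fE fw.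
rewrite mul1r => /(congr1 t); rewrite !rmorphXn -!horner_int_map tx.
move/(congr1 Num.norm)/eqP; rewrite !normrX eqrXn2 // => /eqP nij.
apply/eqP/val_inj/eqP; apply/negPn; rewrite neq_ltn; apply/negP => /orP[] /s_anti.
  by rewrite nij ltxx.
by rewrite nij ltxx.
Qed.
End NontorsionUnit.

(* Both sides say that the discriminant of [f] is nonnegative. *)
Lemma quadratic_real_root (F : realDomainType) (f : {poly int}) (r : F) (w : algC) :
  f \is monic -> size f = 3%N -> root (map_poly intr f) r -> root (map_poly intr f) w ->
  w \is Num.real.
Proof.
move=> f_mon f3 /(monic_root3 _ f_mon f3) + /(monic_root3 _ f_mon f3).
set a := f`_1; set b := f`_0 => rE wE.
have disc (L : comNzRingType) (y : L) : y ^+ 2 + a%:~R * y + b%:~R = 0 ->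
    (2 * y + a%:~R) ^+ 2 = (a ^+ 2 - 4 * b)%:~R.
  move=> yE; rewrite rmorphB rmorphXn rmorphM /=.
  transitivity (a%:~R ^+ 2 - 4 * b%:~R + 4 * (y ^+ 2 + a%:~R * y + b%:~R)); first by ring.
  by rewrite yE mulr0 addr0.
have D0 : 0 <= a ^+ 2 - 4 * b by rewrite -(ler0z F) -(disc _ _ rE) sqr_ge0.
have : 2 * w + a%:~R \is Num.real by rewrite realEsqr (disc _ _ wE) ler0z.
move=> wR; have -> : w = (2 * w + a%:~R - a%:~R) / 2 by field.
by rewrite realM ?realV ?realn // realB // Rreal_int ?intr_int.
Qed.

Theorem mainTheorem8 (K : fieldExtType rat) (n : nat) (hn : (1 <= n)%N) :
  positive_generalized_identity (upper_group n (ring_of_integers K)) <->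
  ({:K} = 1)%VS \/ imaginary_quadratic K.
Proof.
split=> [/(pgi_unit_exponent hn)[k k0 kP]|K12]; last first.
  by apply: (@unit_exponent_pgi _ _ 12) => // u; apply: unit_exponent12.
have [x [f [genx f_mon fE]]] := primitive_integer K.
set d := \dim {:K}%VS.
have fd : size f = d.+1.
  by rewrite (size_minPoly_int fE) /d genx dim_Fadjoin dimv1 muln1.
have d_gt0 : (0 < d)%N by rewrite -ltnS -fd (size_minPoly_int fE) /adjoin_degree.
have [d1|d1] := eqVneq d 1%N.
  by left; apply/esym/eqP; rewrite eqEdim sub1v dimv1 -/d d1.
have d_gt1 : (1 < d)%N by rewrite ltn_neqAle eq_sym d1.
have /closed_rootP[w fw] : size (map_poly (intr : int -> algC) f) != 1%N.
  by rewrite size_map_inj_poly ?rmorph0 ?fd ?eqSS -?lt0n //; apply: intr_inj.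
(* The finite unit exponent excludes both kinds of root, so for [d > 1] only a non-real [w] with
   [d = 2] survives. *)
have noU : ~ ((w \is Num.real /\ (1 < d)%N) \/ (w \isn't Num.real /\ (2 < d)%N)).
  by move=> wd; have [u /kP-> /eqP] := nontorsion_unit genx f_mon fE fd fw wd k0.
have [wR|wR] := boolP (w \is Num.real); first by case: noU; left.
have [d2|d2] := ltnP 2 d; first by case: noU; right.
have {d2}d2 : d = 2%N by apply/eqP; rewrite eqn_leq d2.
(* A morphism [t] to the reals makes [t x] a real root of the quadratic [f], and then [w] would be
   real too. *)
right; split=> // -[t]; case/negP: wR.
apply: (@quadratic_real_root Rdefinitions.R f (t x)) => //; first by rewrite fd d2.
by rewrite rootE horner_int_map fE (rootP (root_minPoly _ _)) rmorph0.
Qed.
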